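(* Let $g:\mathbb{R}^n\to\mathbb{R}$ be continuously differentiable with Lipschitz continuous gradient, i.e. there is $L>0$ with $\|\nabla g(u)-\nabla g(v)\|\le L\|u-v\|$ for all $u,v\in\mathbb{R}^n$; let $h:\mathbb{R}^n\to\mathbb{R}\cup\{+\infty\}$ be proper, lower semicontinuous and convex; and let $f=g+h$. Let $\{x_k\}$ (with associated residuals $\{\eta_k\}$) be generated by the proximal nonlinear conjugate gradient algorithm described in the context. If $f$ is bounded below, then $$\lim_{k\to\infty}\|\eta_k\|=0 .$$ Furthermore, if $\{x_k\}$ is bounded, then any accumulation point $\bar x$ of $\{x_k\}$ is a stationary point of $\min_{x} f(x)$, i.e. $0\in\nabla g(\bar x)+\partial h(\bar x)$.
   Context: Notation: $\|\cdot\|$ is the Euclidean norm; $\partial h$ is the convex subdifferential; for $\mu>0$, $\operatorname{prox}_{\mu h}(v)=\operatorname{argmin}_{x}\{h(x)+\frac{1}{2\mu}\|x-v\|^2\}$; $\operatorname{dom} f=\{x: f(x)<\infty\}$. Algorithm (proximal nonlinear conjugate gradient method). Given $x_0\in\operatorname{dom} f$ and parameters $\mu_{-1}>0$, $\kappa,\delta,\theta,\bar t,\tau\in(0,1)$, $\bar\nu>0$, $T>\delta$. For $k=0,1,2,\dots$: Step 1. Let $\mu_k$ be the largest value in $\{\mu_{k-1},\mu_{k-1}\kappa,\mu_{k-1}\kappa^2,\dots\}$ such that $x_k^+:=\operatorname{prox}_{\mu_k h}(x_k-\mu_k\nabla g(x_k))$ satisfies $g(x_k^+)\le g(x_k)+\nabla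 g(x_k)^\top(x_k^+-x_k)+\frac{1}{2\mu_k}\|x_k^+-x_k\|^2$. Put $\eta_k:=-\frac{1}{\mu_k}(x_k^+-x_k)$ (the forward-backward residual). Step 2. Stop if $\eta_k=0$. Step 3. If $k=0$ set $d_0=-\eta_0$. If $k\ge1$ set $s_{k-1}=x_k-x_{k-1}$, $y_{k-1}=\eta_k-\eta_{k-1}$, $z_{k-1}=y_{k-1}+\nu_k s_{k-1}$, where $\nu_k\ge0$ is any number chosen so that $s_{k-1}^\top z_{k-1}\ge\bar\nu\|s_{k-1}\|^2$, and $$d_k=-\eta_k+\beta_kd_{k-1}-\gamma_ky_{k-1},\quad \beta_k=\frac{\eta_k^\top y_{k-1}}{d_{k-1}^\top z_{k-1}},\quad \gamma_k=\frac{\eta_k^\top d_{k-1}}{d_{k-1}^\top z_{k-1}}.$$ Step 4. Find the largest $t\in\{1,\theta,\theta^2,\dots\}$ satisfying $t\nabla g(x_k)^\top d_k+h(x_k+td_k)-h(x_k)\le -tT\|\eta_k\|^2$. If such a $t$ exists and $t>\bar t$, set $\alpha_{\rm init}=t$ and go to Step 4.1; otherwise go to Step 4.2. Step 4.1. Let $\alpha_k$ be the largest value in $\{\alpha_{\rm init},\tau\alpha_{\rm init},\tau^2\alpha_{\rm init},\dots\}$ with $f(x_k+\alpha_kd_k)\le f(x_k)+\delta\alpha_k\eta_k^\top d_k$; set $x_{k+1}=x_k+\alpha_kd_k$. Step 4.2. Redefine $d_k=-\eta_k$ (this $d_k$ is the one used at iteration $k+1$) and set $x_{k+1}=x_k^+$.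 The sequences are understood to be infinite, i.e. $\eta_k\neq0$ for all $k$. *)

(* Defs.v *)
(* Written in MathComp and MathComp-Analysis. *)
From HB Require Import structures.
From mathcomp Require Import all_boot all_order all_algebra.
From mathcomp Require Import all_classical all_reals all_analysis.

Set Implicit Arguments.
Unset Strict Implicit.
Unset Printing Implicit Defensive.

Import Order.TTheory GRing.Theory Num.Theory.
Import numFieldNormedType.Exports.

Local Open Scope classical_set_scope.
Local Open Scope ring_scope.

(* The library's norm on 'rV[R]_n is the max norm; the Euclidean one is
   l2norm. Both induce the library's topology on 'rV[R]_n. *)
Definition dot (R : realType) (n : nat) (u v : 'rV[R]_n) : R :=
  \sum_(i < n) u 0 i * v 0 i.

Definition l2norm (R : realType) (n : nat) (u : 'rV[R]_n) : R :=
  Num.sqrt (dot u u).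

Definition grad (R : realType) (n : nat) (g : 'rV[R]_n -> R) (x : 'rV[R]_n) :
    'rV[R]_n :=
  \row_(i < n) 'D_(delta_mx 0 i) g x.

Definition C1 (R : realType) (n : nat) (g : 'rV[R]_n -> R) : Prop :=
  (forall x, differentiable g x) /\ continuous (grad g).

Definition eproper (R : realType) (T : Type) (h : T -> \bar R) : Prop :=
  (forall x, -oo < h x)%E /\ (exists x, h x < +oo)%E.

Definition econvex (R : realType) (n : nat) (h : 'rV[R]_n -> \bar R) : Prop :=
  forall (x y : 'rV[R]_n) (t : R), 0 < t < 1 ->
    (h (t *: x + (1 - t) *: y)%R <= t%:E * h x + (1 - t)%R%:E * h y)%E.

Definition edom (R : realType) (T : Type) (f : T -> \bar R) : set T :=
  [set x | (f x < +oo)%E].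

Definition argmin (R : realType) (T : Type) (f : T -> \bar R) : set T :=
  [set p | forall x, (f p <= f x)%E].

(* For h proper, lower semicontinuous and convex and mu > 0 the argmin is a
   singleton, and get returns its element. *)
Definition prox (R : realType) (n : nat) (mu : R) (h : 'rV[R]_n -> \bar R)
    (v : 'rV[R]_n) : 'rV[R]_n :=
  get (argmin (fun x => (h x + ((2 * mu)^-1 * l2norm (x - v) ^+ 2)%R%:E)%E)).

Definition subdifferential (R : realType) (n : nat) (h : 'rV[R]_n -> \bar R)
    (x : 'rV[R]_n) : set 'rV[R]_n :=
  [set v | forall y, (h x + (dot v (y - x)%R)%:E <= h y)%E].

Definition composite (R : realType) (n : nat) (g : 'rV[R]_n -> R)
    (h : 'rV[R]_n -> \bar R) (x : 'rV[R]_n) : \bar R :=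
  ((g x)%:E + h x)%E.

Definition stationary (R : realType) (n : nat) (g : 'rV[R]_n -> R)
    (h : 'rV[R]_n -> \bar R) (x : 'rV[R]_n) : Prop :=
  [set grad g x + v | v in subdifferential h x] 0.

Definition is_largest (R : realType) (A : set R) (a : R) : Prop :=
  A a /\ ubound A a.

(* mu_init is the value with index -1 of the sequence of proximal parameters. *)
Record pncg_param (R : realType) := PncgParam {
  mu_init : R;
  kappa : R;
  delta : R;
  theta : R;
  tbar : R;
  tau : R;
  nubar : R;
  bigT : R;
  mu_init_gt0 : 0 < mu_init;
  kappa01 : 0 < kappa < 1;
  delta01 : 0 < delta < 1;
  theta01 : 0 < theta < 1;
  tbar01 : 0 < tbar < 1;
  tau01 : 0 < tau < 1;
  nubar_gt0 : 0 < nubar;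
  bigT_gt_delta : delta < bigT
}.

Section Algorithm.
Context (R : realType) (n : nat) (P : pncg_param R).
Context (g : 'rV[R]_n -> R) (h : 'rV[R]_n -> \bar R).
Implicit Types (u d eta : 'rV[R]_n) (t m : R).

Definition fb_step m u : 'rV[R]_n := prox m h (u - m *: grad g u).

Definition prox_trials (mu_prev : R) u : set R :=
  [set m | range (geometric mu_prev (kappa P)) m /\
    g (fb_step m u) <= g u + dot (grad g u) (fb_step m u - u)
                       + (2 * m)^-1 * l2norm (fb_step m u - u) ^+ 2].

Definition init_trials u eta d : set R :=
  [set t | range (geometric 1 (theta P)) t /\
    ((t * dot (grad g u) d)%R%:E + h (u + t *: d)%R - h u
       <= (- (t * bigT P * l2norm eta ^+ 2))%R%:E)%E].

Definition armijo_trials (alpha_init : R) u eta d : set R :=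
  [set a | range (geometric alpha_init (tau P)) a /\
    (composite g h (u + a *: d)%R
       <= composite g h u + (delta P * a * dot eta d)%R%:E)%E].

(* dt k is the direction computed in step 3, d k the one left at the end of
   iteration k (step 4.2 overwrites it); the recursion of step 3 uses d. The
   value nu 0 is not used. *)
Record pncg_run (x xp eta dt d : nat -> 'rV[R]_n) (mu nu : nat -> R) : Prop :=
  PncgRun {
  run_start : edom (composite g h) (x 0%N);
  run_mu : forall k,
    is_largest
      (prox_trials (if k is k'.+1 then mu k' else mu_init P) (x k)) (mu k);
  run_xp : forall k, xp k = fb_step (mu k) (x k);
  run_eta : forall k, eta k = - ((mu k)^-1 *: (xp k - x k));
  run_infinite : forall k, eta k != 0;
  run_dt0 : dt 0%N = - eta 0%N;
  run_dtS : forall k,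
    let s := x k.+1 - x k in
    let y := eta k.+1 - eta k in
    let z := y + nu k.+1 *: s in
    let beta := dot (eta k.+1) y / dot (d k) z in
    let gamma := dot (eta k.+1) (d k) / dot (d k) z in
    [/\ 0 <= nu k.+1,
        nubar P * l2norm s ^+ 2 <= dot s z &
        dt k.+1 = - eta k.+1 + beta *: d k - gamma *: y];
  run_update : forall k,
    let success t :=
      is_largest (init_trials (x k) (eta k) (dt k)) t /\ tbar P < t in
    (exists t alpha,
       [/\ success t,
           is_largest (armijo_trials t (x k) (eta k) (dt k)) alpha,
           d k = dt k &
           x k.+1 = x k + alpha *: d k])
    \/
    [/\ ~ (exists t, success t), d k = - eta k & x k.+1 = xp k]
}.

End Algorithm.

(* Main.v *)
(** Because of the three-term form, every search direction satisfies
    [eta_k . d_k = - |eta_k|^2]. Backtracking on [mu] stops as soon as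
    [mu <= 1 / L], so [mu_k] is eventually constant; from then on the residual
    map is Lipschitz and the curvature condition on [z] yields
    [|d_k| <= D |eta_k|]. By the descent lemma and the convexity of [h], the
    Armijo step sizes are then bounded below, and a forward-backward step also
    decreases [f] by a fixed multiple of [|eta_k|^2]. As [f] is bounded below,
    [eta_k] tends to 0. Stationarity is the limit of
    [eta_k - grad g (x_k) \in subdifferential h (x_k^+)] along a subsequence,
    using lower semicontinuity of [h] and [x_k^+ - x_k = - mu_k eta_k]. *)

Require Import Defs.
From HB Require Import structures.
From mathcomp Require Import all_boot all_order all_algebra.
From mathcomp Require Import all_classical all_reals all_analysis.
From mathcomp Require Import ring lra.

Import Order.TTheory GRing.Theory Num.Theory.
Import numFieldNormedType.Exports.

Local Open Scope classical_set_scope.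
Local Open Scope ring_scope.

(** * Euclidean inner product and norm, and their comparison with the max norm *)

Section Euclidean.
Context {R : realType} {n : nat}.
Implicit Types (u v w : 'rV[R]_n) (a : R).

Lemma dotC u v : dot u v = dot v u.
Proof. by apply: eq_bigr => i _; rewrite mulrC. Qed.

Lemma dotDl u v w : dot (u + v) w = dot u w + dot v w.
Proof. by rewrite -big_split; apply: eq_bigr => i _; rewrite mxE mulrDl. Qed.

Lemma dotZl a u w : dot (a *: u) w = a * dot u w.
Proof. by rewrite mulr_sumr; apply: eq_bigr => i _; rewrite mxE mulrA. Qed.

Lemma dotNl u w : dot (- u) w = - dot u w.
Proof. by rewrite -scaleN1r dotZl mulN1r. Qed.

Lemma dotDr u v w : dot u (v + w) = dot u v + dot u w.
Proof. by rewrite !(dotC u) dotDl. Qed.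

Lemma dotZr a u w : dot u (a *: w) = a * dot u w.
Proof. by rewrite !(dotC u) dotZl. Qed.

Lemma dotNr u w : dot u (- w) = - dot u w.
Proof. by rewrite !(dotC u) dotNl. Qed.

Definition dot_linE := (dotDl, dotDr, dotNl, dotNr, dotZl, dotZr).

Lemma dot_ge0 u : 0 <= dot u u.
Proof. by apply: sumr_ge0 => i _; rewrite -expr2 sqr_ge0. Qed.

Lemma l2norm_ge0 u : 0 <= l2norm u.
Proof. exact: sqrtr_ge0. Qed.

Lemma sqr_l2norm u : l2norm u ^+ 2 = dot u u.
Proof. by rewrite sqr_sqrtr ?dot_ge0. Qed.

Lemma coord_le_l2norm u i : `|u 0 i| <= l2norm u.
Proof.
rewrite -(@ler_pXn2r _ 2) ?nnegrE ?l2norm_ge0// sqr_l2norm real_normK ?num_real//.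
rewrite /dot (bigD1 i)//= -expr2 lerDl; apply: sumr_ge0 => j _.
by rewrite -expr2 sqr_ge0.
Qed.

Lemma mx_norm_le_l2norm u : `|u| <= l2norm u.
Proof.
rewrite [leLHS]/Num.norm /= mx_normrE; apply/bigmax_leP; split; first exact: l2norm_ge0.
by move=> [i j] _ /=; rewrite ord1; exact: coord_le_l2norm.
Qed.

Lemma l2norm_eq0 u : (l2norm u == 0) = (u == 0).
Proof.
apply/eqP/eqP => [u0|->]; last first.
  by rewrite /l2norm -(scale0r 0) dotZl mul0r sqrtr0.
by apply/eqP; rewrite -normr_eq0 eq_le normr_ge0 -u0 mx_norm_le_l2norm.
Qed.

Lemma l2norm_gt0 u : (0 < l2norm u) = (u != 0).
Proof. by rewrite lt0r l2norm_eq0 l2norm_ge0 andbT. Qed.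

Lemma l2normN u : l2norm (- u) = l2norm u.
Proof. by rewrite /l2norm dotNl dotNr opprK. Qed.

Lemma l2normZ a u : l2norm (a *: u) = `|a| * l2norm u.
Proof. by rewrite /l2norm dotZl dotZr mulrA -expr2 sqrtrM ?sqr_ge0// sqrtr_sqr. Qed.

(* [0 <= `| |v| u - |u| v |^2 = 2 |u| |v| (|u| |v| - u.v)] *)
Lemma dot_le_l2norm u v : dot u v <= l2norm u * l2norm v.
Proof.
have [->|u0] := eqVneq u 0.
  by rewrite -{1}(scale0r v) dotZl mul0r mulr_ge0 ?l2norm_ge0.
have [->|v0] := eqVneq v 0.
  by rewrite -{1}(scale0r u) dotZr mul0r mulr_ge0 ?l2norm_ge0.
have := dot_ge0 (l2norm v *: u - l2norm u *: v).
rewrite !dot_linE -!sqr_l2norm (dotC v u).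
move=> sq_ge0; have : 0 <= (2 * l2norm u * l2norm v) *
  (l2norm u * l2norm v - dot u v) by lra.
rewrite pmulr_rge0 ?subr_ge0//.
by rewrite !mulr_gt0 ?l2norm_gt0.
Qed.

Lemma normr_dot_le_l2norm u v : `|dot u v| <= l2norm u * l2norm v.
Proof.
rewrite ler_norml dot_le_l2norm andbT lerNl -dotNl -(l2normN u).
exact: dot_le_l2norm.
Qed.

Lemma ler_l2normD u v : l2norm (u + v) <= l2norm u + l2norm v.
Proof.
rewrite -(@ler_pXn2r _ 2) ?nnegrE ?addr_ge0 ?l2norm_ge0//.
rewrite sqr_l2norm !dot_linE -!sqr_l2norm (dotC v u).
by have := dot_le_l2norm u v; lra.
Qed.

Lemma ler_l2normB u v : l2norm (u - v) <= l2norm u + l2norm v.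
Proof. by rewrite -(l2normN v) ler_l2normD. Qed.

Lemma cvg_dot {T : Type} (F : set_system T) {FF : Filter F}
    (p q : T -> 'rV[R]_n) u v :
  p @ F --> u -> q @ F --> v -> dot (p t) (q t) @[t --> F] --> dot u v.
Proof.
move=> pu qv; apply: (@cvg_big R); first exact: (@add_continuous R).
have cvg_coord (r : T -> 'rV[R]_n) w i :
    r @ F --> w -> r t 0 i @[t --> F] --> w 0 i.
  by move=> rw; apply: (continuous_cvg _ (@coord_continuous _ _ _ 0 i w) rw).
by move=> i _; apply: cvgM; exact: cvg_coord.
Qed.

Lemma continuous_sqr_l2norm v : continuous (fun u => l2norm (u - v) ^+ 2).
Proof.
under [fun u => _]funext do rewrite sqr_l2norm.
move=> u; have cB : (w - v) @[w --> nbhs u] --> u - v.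
  apply: (@cvgB _ _ _ (nbhs u)); [exact: cvg_id|exact: cvg_cst].
exact: (@cvg_dot _ (nbhs u) _ _ _ _ _ cB cB).
Qed.

End Euclidean.

(** * Directional derivatives, gradients and the descent lemma *)

Section Smooth.
Context {R : realType} {n : nat} {g : 'rV[R]_n -> R}.
Implicit Types u v w : 'rV[R]_n.

Lemma deriveE_grad u v : differentiable g u -> 'D_v g u = dot (grad g u) v.
Proof.
move=> dg; rewrite deriveE// {1}(row_sum_delta v) linear_sum.
apply: eq_bigr => i _; rewrite linearZ mxE deriveE//= mulrC.
by rewrite /GRing.scale.
Qed.

Lemma is_derive_line u w (t : R) : differentiable g (u + t *: w) ->
  is_derive t 1 (fun s : R => g (u + s *: w)) (dot (grad g (u + t *: w)) w).
Proof.
move=> dg; rewrite -deriveE_grad//.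
have gE : (fun h : R => h^-1 *: (g (u + (h *: 1 + t) *: w) - g (u + t *: w))) =
          (fun h : R => h^-1 *: (g (h *: w + (u + t *: w)) - g (u + t *: w))).
  apply/funext => h; congr (_ *: (g _ - _)).
  by rewrite scalerDl addrCA -scalerA scale1r.
have dw : derivable g (u + t *: w) w by exact: diff_derivable.
split; first by rewrite /derivable/= gE.
by rewrite /derive/= gE.
Qed.

(** Mean value theorem on [[0, 1]] for [psi], the restriction of [g] to the segment minus the
    quadratic [c1 t + c2 t^2]: by Cauchy-Schwarz and the Lipschitz bound, [dpsi t <= 0] there. *)
Lemma descent_lemma L : (forall x, differentiable g x) ->
  (forall u v, l2norm (grad g u - grad g v) <= L * l2norm (u - v)) ->
  forall u v, g v <= g u + dot (grad g u) (v - u) + L / 2 * l2norm (v - u) ^+ 2.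
Proof.
move=> dg lip u v; set w := v - u.
pose c1 := dot (grad g u) w; pose c2 := L / 2 * l2norm w ^+ 2.
pose psi : R -> R :=
  (fun t : R => g (u + t *: w)) - (c1 \*: id + c2 \*: (id ^+ 2) : R -> R).
pose dpsi t := dot (grad g (u + t *: w)) w - (c1 + 2 * t * c2).
have dpsiP (t : R) : is_derive t (1 : R) psi (dpsi t).
  have dl := is_derive_line _ w t (dg (u + t *: w)).
  have dq : is_derive t (1 : R) (c1 \*: id + c2 \*: (id ^+ 2) : R -> R)
      (c1 *: 1 + c2 *: ((2 * t) *: 1)).
    by apply: is_deriveD; apply: is_deriveZ.
  apply: (is_derive_eq (is_deriveB dl dq)).
  by rewrite /dpsi /GRing.scale/= !mulr1 (mulrC c2).
have [t t01] : exists2 c, c \in `[0, 1] & psi 1 - psi 0 = dpsi c * (1 - 0).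
  apply: MVT_segment => //.
  apply: derivable_within_continuous => t _; exact: ex_derive.
rewrite subr0 mulr1 /psi !fctE/= !scale1r scale0r addr0 subrKC => psiE.
suff : dpsi t <= 0 by rewrite -psiE /c2 /c1 /GRing.scale/=; lra.
move: t01; rewrite in_itv/= => /andP[t0 t1].
rewrite /dpsi /c1 /c2 opprD addrA -dotNl -dotDl subr_le0.
apply: (le_trans (dot_le_l2norm _ _)).
apply: (@le_trans _ _ (L * l2norm (t *: w) * l2norm w)).
  apply: ler_wpM2r; first exact: l2norm_ge0.
  by have := lip (u + t *: w) u; rewrite addrAC subrr add0r.
rewrite l2normZ ger0_norm// le_eqVlt; apply/orP; left; apply/eqP.
by field.
Qed.

End Smooth.

(** * Minimisation of lower semicontinuous functions on compact sets *)

Section LowerSemicontinuous.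
Context {R : realType} {T : topologicalType}.
Context {f : T -> \bar R}.

(** The sublevel sets of [f] in [K] at levels [f q] are nested, hence a filter base, and compactness
    gives a cluster point [p]. If [f x < f p], semicontinuity makes [f > f x] near [p], away from
    the sublevel set of [x]. *)
Lemma lsc_compact_min {K : set T} : lower_semicontinuous f -> (forall x, -oo < f x)%E ->
  compact K -> K !=set0 -> exists2 p, K p & forall x, K x -> (f p <= f x)%E.
Proof.
move=> lscf fNy cK [x0 Kx0].
pose F := filter_from K (fun q => K `&` [set x | f x <= f q]%E).
have FF : ProperFilter F.
  apply: filter_from_proper; last by move=> q Kq; exists q; split => /=.
  apply: filter_from_filter; first by exists x0.
  move=> q r Kq Kr; have [qr|rq] := leP (f q) (f r).
    by exists q => // x [Kx xq]; do 2!split => //=; exact: le_trans qr.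
  by exists r => // x [Kx xr]; do 2!split => //=; exact: le_trans (ltW rq).
have [|p [Kp clp]] := cK F FF; first by exists x0 => // x [].
exists p => // x Kx; rewrite leNgt; apply/negP => xp.
have nU : nbhs p [set y | f x < f y]%E.
  case fxE : (f x) (fNy x) xp => [r| |] // _ rp; last by rewrite ltNge leey in rp.
  by have [V nV Vr] := lscf _ _ rp; apply: filterS nV => y /Vr.
have Fx : F (K `&` [set y | f y <= f x]%E) by exists x.
by have [y [[_ /= yx]]] := clp _ _ Fx nU; rewrite /= ltNge yx.
Qed.

Lemma lscD_continuous {q : T -> R} : lower_semicontinuous f ->
  (forall x, -oo < f x)%E -> continuous q ->
  lower_semicontinuous (fun x => f x + (q x)%:E)%E.
Proof.
move=> lscf fNy cq x a ax.
(* [b] splits the bound [a]: near [x], [f] stays above [b] and [q] above [a - b]. The two cases are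
   [f x] real and [f x = +oo]. *)
have [b [ab bx]] : exists b, a - q x < b /\ (b%:E < f x)%E.
  case fxE : (f x) (fNy x) ax => [r| |] // _.
    rewrite -EFinD lte_fin => ax; exists ((a - q x + r) / 2).
    by rewrite lte_fin; split; lra.
  by exists (a - q x + 1); rewrite ltry ltrDl.
have [V nV Vb] := lscf _ _ bx.
exists (V `&` [set y | a - b < q y]).
  by apply: filterI => //; apply: (cvgr_gt _ (cq x)); lra.
move=> y [/Vb/= by_ abq].
case fyE : (f y) (fNy y) by_ => [r| |] // _; last by move=> _; rewrite addye ?ltry.
by rewrite -EFinD !lte_fin; lra.
Qed.

End LowerSemicontinuous.

Lemma compact_l2ball {R : realType} {n : nat} (c : 'rV[R]_n) (r : R) :
  compact [set x | l2norm (x - c) <= r].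
Proof.
apply: bounded_closed_compact.
  apply: (@filterS _ (pinfty_nbhs R)); last exact: (nbhs_pinfty_ge (num_real (r + `|c|))).
  move=> M /= rM x /= xr; rewrite -(subrK c x).
  apply: (le_trans (ler_normD _ _)); apply: le_trans rM.
  by rewrite lerD2r (le_trans (mx_norm_le_l2norm _)).
(* The norm is compared with [r] through squares, which requires [0 <= r]; for [r < 0] the ball is
   empty. *)
have [r0|r0] := leP 0 r; last first.
  rewrite (_ : [set _ | _] = set0); first exact: closed0.
  by apply/seteqP; split => // x /= xr; have := l2norm_ge0 (x - c); lra.
rewrite (_ : [set _ | _] = (fun x => l2norm (x - c) ^+ 2) @^-1` [set y | y <= r ^+ 2]).
  apply: preimage_closed; last exact: closed_le.
  by move=> x _; exact: continuous_sqr_l2norm.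
by apply/seteqP; split => x /=; rewrite ler_pXn2r ?nnegrE ?l2norm_ge0.
Qed.

(** Replaces the limit [t -> 0] in first-order optimality arguments. If [a > 0], then
    [t = a / (2 (a + b))] gives [t b < a]. *)
Lemma le0_of_le_small {R : realType} (a b : R) :
  (forall t, 0 < t < 1 -> a <= t * b) -> a <= 0.
Proof.
move=> ab; rewrite leNgt; apply/negP => a0.
have b0 : 0 < b by have := ab 2^-1; lra.
have ab0 : 0 < 2 * (a + b) by lra.
have t01 : 0 < a / (2 * (a + b)) < 1.
  by rewrite divr_gt0//= ltr_pdivrMr//; lra.
by have := ab _ t01; rewrite mulrAC ler_pdivlMr//; nra.
Qed.

(** * Existence of the proximal point and its optimality condition *)

Section Convex.
Context {R : realType} {n : nat} {h : 'rV[R]_n -> \bar R}.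
Hypotheses (h_proper : eproper h) (h_lsc : lower_semicontinuous h)
  (h_convex : econvex h).
Implicit Types (u v p y z : 'rV[R]_n).

Lemma eproper_dom_fineK {z} : (h z < +oo)%E -> h z = (fine (h z))%:E.
Proof.
by move=> hz; rewrite fineK// fin_numElt h_proper.1.
Qed.

Lemma econvex_fine {y z} {t : R} : (h y < +oo)%E -> (h z < +oo)%E -> 0 < t < 1 ->
  (h (t *: y + (1 - t) *: z) <= (t * fine (h y) + (1 - t) * fine (h z))%:E)%E.
Proof.
move=> hy hz t01; have := h_convex y z t t01.
by rewrite {1}(eproper_dom_fineK hy) {1}(eproper_dom_fineK hz) -!EFinM -EFinD.
Qed.

(* [h] is bounded below on a unit ball by compactness; convexity along rays
   issued from the centre propagates this to a linear bound. *)
Lemma convex_linear_lower_bound {z} : (h z < +oo)%E ->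
  exists2 C : R, 0 <= C &
    forall x, ((fine (h z) - C * (1 + l2norm (x - z)))%:E <= h x)%E.
Proof.
move=> hz.
have [|p _ pmin] := lsc_compact_min h_lsc h_proper.1 (compact_l2ball z 1).
  by exists z; rewrite /= subrr (eqP (_ : l2norm 0 == 0)) ?l2norm_eq0.
have zball : l2norm (z - z) <= 1 by rewrite subrr (eqP (_ : l2norm 0 == 0)) ?l2norm_eq0.
have hpz := pmin z zball.
have hp : (h p < +oo)%E by exact: le_lt_trans hz.
have mr : fine (h p) <= fine (h z).
  by rewrite -lee_fin -!eproper_dom_fineK.
exists (fine (h z) - fine (h p)); first by rewrite subr_ge0.
move=> x; set r := l2norm (x - z); have r0 : 0 <= r by exact: l2norm_ge0.
have [r1|r1] := leP r 1.
  apply: le_trans (pmin x r1); rewrite [leRHS]eproper_dom_fineK// lee_fin; nra.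
have [hx|] := ltP (h x) +oo%E; last by rewrite leye_eq => /eqP ->; rewrite leey.
have ri : 0 < r^-1 < 1 by rewrite invr_gt0 invf_lt1 ?r1 ?(lt_trans _ r1).
(* [y] is the point of the segment from [z] to [x] at distance 1 from [z], so [h p <= h y].
   Multiplying the convexity inequality by [r] gives [h x >= h z - C r]. *)
have := econvex_fine hx hz ri.
set y := _ + _.
have yz : y - z = r^-1 *: (x - z).
  by apply/rowP => i; rewrite !mxE; ring.
have ry : r^-1 * r = 1 by rewrite mulVf// gt_eqF// (lt_trans _ r1).
have /pmin hpy : l2norm (y - z) <= 1.
  by rewrite yz l2normZ ger0_norm ?ry// invr_ge0.
move=> /(le_trans hpy); rewrite [X in (X <= _)%E]eproper_dom_fineK// lee_fin.
rewrite [X in _ -> (_ <= X)%E]eproper_dom_fineK// lee_fin => ineq.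
have {}ineq := ler_wpM2l r0 ineq.
have rr : r * r^-1 = 1 by rewrite mulrC.
have : r * (r^-1 * fine (h x) + (1 - r^-1) * fine (h z)) =
  (r * r^-1) * fine (h x) + (r - r * r^-1) * fine (h z) by ring.
rewrite rr mul1r; lra.
Qed.

(** The quadratic term outgrows the linear lower bound of [h], so [phi] is at least [phi z] outside
    a large ball around [z]; the minimum over that ball is then global. *)
Lemma argmin_prox_neq0 {mu : R} v : 0 < mu ->
  argmin (fun x => h x + ((2 * mu)^-1 * l2norm (x - v) ^+ 2)%:E)%E !=set0.
Proof.
move=> mu0; set c := (2 * mu)^-1.
have c0 : 0 < c by rewrite invr_gt0; lra.
have [z hz] := h_proper.2.
have [C C0 hC] := convex_linear_lower_bound hz.
set phi := (fun x => _); set a := l2norm (z - v).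
have a0 : 0 <= a by exact: l2norm_ge0.
(* Beyond [rho], [r >= 1] gives [C (1 + r) <= 2 C r], and [r >= 2 a + 2 C / c] gives
   [c r^2 >= 2 c r a + 2 C r]. *)
pose rho := 1 + 2 * a + 2 * C / c.
have Cc0 : 0 <= 2 * C / c by rewrite divr_ge0 ?mulr_ge0// ltW.
have rho1 : 1 <= rho by rewrite /rho; lra.
have phiNy x : (-oo < phi x)%E.
  by rewrite /phi; case: (h x) (h_proper.1 x) => [s| |] // _; rewrite -EFinD ltNyr.
have lphi : lower_semicontinuous phi.
  apply: lscD_continuous => //; first exact: h_proper.1.
  move=> x; apply: (@cvgM _ _ (nbhs x)); first exact: cvg_cst.
  exact: continuous_sqr_l2norm.
have zball : l2norm (z - z) <= rho.
  by rewrite subrr (eqP (_ : l2norm 0 == 0)) ?l2norm_eq0// (le_trans _ rho1).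
have [|p _ pmin] := lsc_compact_min lphi phiNy (compact_l2ball z rho).
  by exists z.
exists p => x; set r := l2norm (x - z).
have [/pmin//|rr] := leP r rho.
apply: (le_trans (pmin z zball)).
have : ((fine (h z) - C * (1 + r))%:E + (c * l2norm (x - v) ^+ 2)%:E <= phi x)%E.
  by apply: leeD2r; exact: hC.
apply: le_trans; rewrite /phi eproper_dom_fineK// -!EFinD lee_fin.
have -> : x - v = (x - z) + (z - v) by rewrite addrA subrK.
have -> : l2norm (x - z + (z - v)) ^+ 2 = r ^+ 2 + 2 * dot (x - z) (z - v) + a ^+ 2.
  by rewrite /r /a !sqr_l2norm dotDl !(dotDr _ (x - z)) (dotC (z - v)) mulrDl mul1r !addrA.
have dle : - (r * a) <= dot (x - z) (z - v).
  by have := normr_dot_le_l2norm (x - z) (z - v); rewrite ler_norml => /andP[].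
rewrite -/a.
have key : 0 <= c * r ^+ 2 - 2 * c * r * a - 2 * C * r.
  have -> : c * r ^+ 2 - 2 * c * r * a - 2 * C * r = c * r * (r - 2 * a - 2 * C / c).
    by field; rewrite gt_eqF.
  by rewrite !mulr_ge0 ?l2norm_ge0 1?ltW//; rewrite /rho in rr; lra.
have r1 : 1 <= r by exact: le_trans (ltW rr).
have : c * - (r * a) <= c * dot (x - z) (z - v) by rewrite ler_pM2l.
have : C <= C * r by rewrite ler_peMr.
rewrite !mulrDr; lra.
Qed.

Lemma prox_dom {mu : R} v : 0 < mu -> (h (prox mu h v) < +oo)%E.
Proof.
move=> mu0; have [z hz] := h_proper.2.
have := getPex (argmin_prox_neq0 v mu0) z; rewrite -/(prox mu h v) => /le_lt_trans.
move=> /(_ +oo%E); rewrite (eproper_dom_fineK hz) -EFinD ltry => /(_ isT).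
by case: (h _) (h_proper.1 (prox mu h v)).
Qed.

(** Minimality of [p] is tested against [t y + (1 - t) p]. After division by [t], the only remainder
    is [t |y - p|^2 / (2 mu)], which vanishes with [t]. *)
Lemma prox_subgradient {mu : R} v : 0 < mu ->
  subdifferential h (prox mu h v) (mu^-1 *: (v - prox mu h v)).
Proof.
move=> mu0 y; set p := prox mu h v.
have hp : (h p < +oo)%E by exact: prox_dom.
have [hy|] := ltP (h y) +oo%E; last by rewrite leye_eq => /eqP ->; rewrite leey.
rewrite (eproper_dom_fineK hp) (eproper_dom_fineK hy) -EFinD lee_fin.
rewrite -subr_le0.
apply: (@le0_of_le_small _ _ ((2 * mu)^-1 * l2norm (y - p) ^+ 2)) => t t01.
have t0 : 0 < t by case/andP: t01.
have := econvex_fine hy hp t01; set w := _ + _ => hw.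
have := getPex (argmin_prox_neq0 v mu0) w; rewrite -/(prox mu h v) -/p.
move=> /le_trans/(_ (leeD2r _ hw)).
rewrite (eproper_dom_fineK hp) -!EFinD lee_fin.
have -> : w - v = (p - v) + t *: (y - p).
  by apply/rowP => i; rewrite !mxE; ring.
have -> : v - p = - (p - v) by rewrite opprB.
move: (y - p) (p - v) => D E; rewrite !sqr_l2norm !dot_linE (dotC D E) => ineq.
rewrite -(ler_pM2l t0); have -> : (2 * mu)^-1 = mu^-1 / 2 by rewrite invfM mulrC.
by move: ineq; rewrite invfM; lra.
Qed.

End Convex.

(** The difference of residuals is [((u - v) - (p - q)) / mu], and nonexpansiveness gives
    [|p - q| <= (1 + mu L) |u - v|]; hence [2 / mu + L]. *)
Lemma l2norm_residual_diff {R : realType} {n : nat} {mu L : R}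
    {p q u v a b : 'rV[R]_n} : 0 < mu ->
  l2norm (p - q) <= l2norm ((u - mu *: a) - (v - mu *: b)) ->
  l2norm (a - b) <= L * l2norm (u - v) ->
  l2norm (- (mu^-1 *: (p - u)) - - (mu^-1 *: (q - v)))
    <= (2 / mu + L) * l2norm (u - v).
Proof.
move=> mu0 nonexp lip.
have -> : - (mu^-1 *: (p - u)) - - (mu^-1 *: (q - v)) =
    mu^-1 *: ((u - v) - (p - q)).
  by apply/rowP => i; rewrite !mxE; ring.
rewrite l2normZ gtr0_norm ?invr_gt0// ler_pdivrMl//.
apply: (le_trans (ler_l2normB _ _)).
have -> : mu * ((2 / mu + L) * l2norm (u - v)) =
  2 * l2norm (u - v) + mu * (L * l2norm (u - v)) by field; rewrite gt_eqF.
have := ler_l2normB (u - v) (mu *: (a - b)).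
have -> : u - v - mu *: (a - b) = u - mu *: a - (v - mu *: b).
  by apply/rowP => i; rewrite !mxE; ring.
rewrite l2normZ gtr0_norm//.
have : mu * l2norm (a - b) <= mu * (L * l2norm (u - v)) by rewrite ler_pM2l.
move: nonexp; lra.
Qed.

(** * Descent properties of the forward-backward step and of the line search *)

Section ForwardBackward.
Context {R : realType} {n : nat} {g : 'rV[R]_n -> R} {h : 'rV[R]_n -> \bar R}.
Hypotheses (h_proper : eproper h) (h_lsc : lower_semicontinuous h)
  (h_convex : econvex h).
Implicit Types (u v p d eta : 'rV[R]_n).

Lemma subdifferential_monotone {p q u v} : (h p < +oo)%E -> (h q < +oo)%E ->
  subdifferential h p u -> subdifferential h q v -> 0 <= dot (u - v) (p - q).
Proof.
move=> hp hq /(_ q) + /(_ p).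
rewrite (eproper_dom_fineK h_proper hp) (eproper_dom_fineK h_proper hq).
rewrite -!EFinD !lee_fin !dot_linE; lra.
Qed.

(* Firm nonexpansiveness, [|p - q|^2 <= (u - v).(p - q)], is monotonicity of
   the subdifferential at the two proximal points. *)
Lemma prox_nonexpansive {mu : R} u v : 0 < mu ->
  l2norm (prox mu h u - prox mu h v) <= l2norm (u - v).
Proof.
move=> mu0; set p := prox mu h u; set q := prox mu h v.
have [pq|pq] := eqVneq (l2norm (p - q)) 0; first by rewrite pq l2norm_ge0.
have pq0 : 0 < l2norm (p - q) by rewrite lt0r pq l2norm_ge0.
have := subdifferential_monotone (prox_dom h_proper h_lsc h_convex u mu0)
  (prox_dom h_proper h_lsc h_convex v mu0)
  (prox_subgradient h_proper h_lsc h_convex u mu0)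
  (prox_subgradient h_proper h_lsc h_convex v mu0).
rewrite -/p -/q -scalerBr dotZl pmulr_rge0 ?invr_gt0//.
move: p q pq pq0 => p q pq pq0.
have -> : u - p - (v - q) = (u - v) - (p - q).
  by apply/rowP => i; rewrite !mxE; ring.
rewrite dotDl dotNl -sqr_l2norm => mono.
rewrite -(ler_pM2r pq0) -expr2 (le_trans _ (dot_le_l2norm _ _))//; lra.
Qed.

Lemma fb_step_subgradient {mu : R} u : 0 < mu ->
  subdifferential h (fb_step g h mu u)
    (- (mu^-1 *: (fb_step g h mu u - u)) - grad g u).
Proof.
move=> mu0; have := prox_subgradient h_proper h_lsc h_convex (u - mu *: grad g u) mu0.
rewrite -/(fb_step g h mu u); congr (subdifferential _ _ _).
by apply/rowP => i; rewrite !mxE; field; rewrite gt_eqF.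
Qed.

Lemma fb_residual_lipschitz {L mu : R} u v : 0 < mu ->
  l2norm (grad g u - grad g v) <= L * l2norm (u - v) ->
  l2norm (- (mu^-1 *: (fb_step g h mu u - u)) - - (mu^-1 *: (fb_step g h mu v - v)))
  <= (2 / mu + L) * l2norm (u - v).
Proof. by move=> mu0; apply: l2norm_residual_diff => //; exact: prox_nonexpansive. Qed.

(** The subgradient inequality at [p], tested at [u], gains [|p - u|^2 / mu] and cancels the
    gradient term of the acceptance test, which costs half of that gain. *)
Lemma fb_step_decrease {mu : R} u : 0 < mu -> (h u < +oo)%E ->
  let p := fb_step g h mu u in
  g p <= g u + dot (grad g u) (p - u) + (2 * mu)^-1 * l2norm (p - u) ^+ 2 ->
  g p + fine (h p) <=
    g u + fine (h u) - mu / 2 * l2norm (- (mu^-1 *: (p - u))) ^+ 2.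
Proof.
move=> mu0 hu p gp.
have hp : (h p < +oo)%E by exact: prox_dom.
have := fb_step_subgradient u mu0 u; rewrite -/p.
rewrite (eproper_dom_fineK h_proper hu) (eproper_dom_fineK h_proper hp) -EFinD lee_fin.
have -> : u - p = - (p - u) by rewrite opprB.
move: gp; rewrite l2normN !sqr_l2norm; move: (p - u) => D.
rewrite !dot_linE invfM.
have -> : mu / 2 * (mu^-1 * (mu^-1 * dot D D)) = 2^-1 * (mu^-1 * dot D D).
  by field; rewrite gt_eqF.
lra.
Qed.

(** By convexity of [h], the initial test at [t] scales down to every [a <= t] with the factor
    [a / t]. The curvature error [L / 2 a^2 |d|^2] is then absorbed by the gap [T - delta]. *)
Lemma linesearch_decrease {L t a delta T : R} {u d eta} :
  (forall v, g v <= g u + dot (grad g u) (v - u) + L / 2 * l2norm (v - u) ^+ 2) ->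
  0 < a <= t -> (h u < +oo)%E ->
  ((t * dot (grad g u) d)%:E + h (u + t *: d)%R - h u
       <= (- (t * T * l2norm eta ^+ 2))%:E)%E ->
  L / 2 * a * l2norm d ^+ 2 <= (T - delta) * l2norm eta ^+ 2 ->
  dot eta d = - l2norm eta ^+ 2 ->
  (composite g h (u + a *: d)
    <= composite g h u + (delta * a * dot eta d)%:E)%E.
Proof.
move=> desc /andP[a0 at_] hu init small ->.
have t0 : 0 < t by exact: lt_le_trans at_.
have hut : (h (u + t *: d) < +oo)%E.
  have [//|] := ltP (h (u + t *: d)) +oo%E; rewrite leye_eq => /eqP hoo.
  by move: init; rewrite (eproper_dom_fineK h_proper hu) hoo addey// addye.
have had : (h (u + a *: d) <=
  ((a / t) * fine (h (u + t *: d)) + (1 - a / t) * fine (h u))%:E)%E.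
  (* [econvex] only covers weights strictly between 0 and 1, so the weight [a / t = 1] is treated
     apart. *)
  have [->|at1] := eqVneq a t.
    by rewrite divff ?gt_eqF// mul1r subrr mul0r addr0 -eproper_dom_fineK.
  have -> : u + a *: d = (a / t) *: (u + t *: d) + (1 - a / t) *: u.
    by apply/rowP => i; rewrite !mxE; field; rewrite gt_eqF.
  apply: econvex_fine => //.
  by rewrite divr_gt0//= ltr_pdivrMr// mul1r lt_neqAle at1.
have := desc (u + a *: d).
have -> : u + a *: d - u = a *: d by rewrite addrAC subrr add0r.
rewrite dotZr l2normZ exprMn real_normK ?num_real// => gad.
rewrite /composite; apply: (le_trans (leeD2l _ had)).
move: init; rewrite (eproper_dom_fineK h_proper hu) (eproper_dom_fineK h_proper hut).
rewrite -!EFinD -?EFinB !lee_fin => init.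
have at0 : 0 < a / t by rewrite divr_gt0.
have := ler_wpM2l (ltW at0) init.
have -> : a / t * (t * dot (grad g u) d + fine (h (u + t *: d)) - fine (h u)) =
  a * dot (grad g u) d + a / t * (fine (h (u + t *: d)) - fine (h u)).
  by field; rewrite gt_eqF.
have -> : a / t * - (t * T * l2norm eta ^+ 2) = - (a * (T * l2norm eta ^+ 2)).
  by field; rewrite gt_eqF.
have := ler_wpM2l (ltW a0) small.
move: gad; lra.
Qed.

End ForwardBackward.

(** * Bound and descent identity for conjugate gradient directions *)

Section Direction.
Context {R : realType} {n : nat}.
Implicit Types (s y z d eta : 'rV[R]_n).

(* The curvature condition bounds [d.z] below by [nubar |s| |d|], which is what
   keeps both conjugacy coefficients under control. *)
Lemma cg_direction_bound {a C nubar : R} {s y z d eta} :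
  0 < a -> 0 < nubar -> 0 <= C -> d != 0 -> s = a *: d ->
  nubar * l2norm s ^+ 2 <= dot s z -> l2norm y <= C * l2norm s ->
  l2norm (- eta + (dot eta y / dot d z) *: d - (dot eta d / dot d z) *: y)
    <= (1 + 2 * C / nubar) * l2norm eta.
Proof.
move=> a0 nubar0 C0 d0 sE curv yC.
have ld0 : 0 < l2norm d by rewrite l2norm_gt0.
have sN : l2norm s = a * l2norm d by rewrite sE l2normZ gtr0_norm.
have dz : nubar * l2norm s * l2norm d <= dot d z.
  rewrite -(ler_pM2l a0) -dotZl -sE (le_trans _ curv)// sN; nra.
have dz0 : 0 < dot d z.
  by apply: lt_le_trans dz; rewrite sN !mulr_gt0.
(* Each of the two corrections has norm at most [|eta|] times this quotient, whence the factor 2 in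
   the bound. *)
have key : l2norm y * l2norm d / dot d z <= C / nubar.
  rewrite ler_pdivrMr// mulrAC ler_pdivlMr//.
  apply: (@le_trans _ _ (C * (nubar * l2norm s * l2norm d))); last by rewrite ler_wpM2l.
  have := ler_wpM2r (mulr_ge0 (ltW ld0) (ltW nubar0)) yC; lra.
have e0 := l2norm_ge0 eta.
have dzi : 0 <= (dot d z)^-1 by rewrite invr_ge0 ltW.
have b1 : l2norm ((dot eta y / dot d z) *: d) <= l2norm eta * (C / nubar).
  rewrite l2normZ normrM (ger0_norm dzi).
  apply: (@le_trans _ _ (l2norm eta * l2norm y * (dot d z)^-1 * l2norm d)).
    by rewrite !ler_wpM2r ?normr_dot_le_l2norm// ltW.
  have := ler_wpM2l e0 key; lra.
have b2 : l2norm ((dot eta d / dot d z) *: y) <= l2norm eta * (C / nubar).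
  rewrite l2normZ normrM (ger0_norm dzi).
  apply: (@le_trans _ _ (l2norm eta * l2norm d * (dot d z)^-1 * l2norm y)).
    by rewrite !ler_wpM2r ?normr_dot_le_l2norm// l2norm_ge0.
  have := ler_wpM2l e0 key; lra.
apply: (le_trans (ler_l2normB _ _)).
have := ler_l2normD (- eta) ((dot eta y / dot d z) *: d).
rewrite l2normN; lra.
Qed.

(* The three-term form makes the two conjugacy corrections cancel against
   [eta], whatever the value of the denominator. *)
Lemma cg_direction_descent (r : R) y d eta :
  dot eta (- eta + (dot eta y / r) *: d - (dot eta d / r) *: y) = - l2norm eta ^+ 2.
Proof. by rewrite sqr_l2norm !dot_linE; ring. Qed.

End Direction.

(** * Backtracking on geometric trials, and real sequences *)

Section RealSequences.
Context {R : realType}.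

(** Shared by the three backtracking loops: unless the first trial is accepted, the preceding trial
    [a / q] was rejected, being larger than the maximum [a]. *)
Lemma largest_geometric {a0 q a : R} {Q : R -> Prop} : 0 < a0 -> 0 < q < 1 ->
  is_largest [set m | range (geometric a0 q) m /\ Q m] a ->
  [/\ 0 < a, a <= a0, Q a & a = a0 \/ a <= q * a0 /\ ~ Q (a / q)].
Proof.
move=> a00 /andP[q0 q1] [[[j _ <-] Qa] ub]; rewrite /geometric/= in Qa ub *.
have qj0 : 0 < q ^+ j by exact: exprn_gt0.
have le1 i : q ^+ i <= 1 by rewrite exprn_ile1// ltW.
split => //; first exact: mulr_gt0; first by rewrite ger_pMr.
case: j Qa ub qj0 => [|j] Qa ub qj0; first by left; rewrite expr0 mulr1.
right; split; first by rewrite exprS mulrCA ler_pM2l// ger_pMr.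
have e : a0 * q ^+ j.+1 / q = a0 * q ^+ j.
  by rewrite exprSr mulrA mulfK// gt_eqF.
rewrite e => Qj; have := ub (a0 * q ^+ j).
move=> /(_ (conj (imageT _ j) Qj)); rewrite exprS ler_pM2l// ler_pMl ?exprn_gt0//.
by rewrite leNgt q1.
Qed.

Lemma eventually_constant {q c : R} {m : nat -> R} : 0 < q < 1 -> 0 < c ->
  (forall k, c <= m k) -> (forall k, m k.+1 = m k \/ m k.+1 <= q * m k) ->
  exists K, forall k, (K <= k)%N -> m k.+1 = m k.
Proof.
move=> /andP[q0 q1] c0 cm step.
have noninc i j : (i <= j)%N -> m j <= m i.
  elim: j => [|j IH]; first by rewrite leqn0 => /eqP ->.
  rewrite leq_eqVlt => /predU1P[-> //|]; rewrite ltnS => /IH; apply: le_trans.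
  case: (step j) => [->//|/le_trans]; apply.
  by rewrite ger_pMl ?(ltW q1)// (lt_le_trans c0).
(* [N] bounds the number of changes left after [k]: a change at [j >= k] gives [m j.+1 <= q * m k],
   which uses up one factor [q], and [N = 0] contradicts [c <= m k]. *)
suff main N : forall k, m k * q ^+ N < c ->
    exists K, forall k, (K <= k)%N -> m k.+1 = m k.
  have : (m 0 * q ^+ N) @[N --> \oo] --> (0 : R).
    by apply: cvg_geometric; rewrite gtr0_norm.
  move=> /cvgrPdist_lt/(_ _ c0)[N _ /(_ N (leqnn N))/=].
  by rewrite sub0r normrN => /(le_lt_trans (ler_norm _)); exact: main.
elim: N => [k|N IH k mk].
  by rewrite expr0 mulr1 ltNge cm.
have [[j kj mj]|] := pselect (exists2 j, (k <= j)%N & m j.+1 != m j).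
  apply: (IH j.+1); apply: le_lt_trans mk.
  rewrite exprS mulrA ler_pM2r ?exprn_gt0//.
  case: (step j) mj => [->|/le_trans mle _]; first by rewrite eqxx.
  by apply: mle; rewrite mulrC ler_pM2r// noninc.
move=> noj; exists k => j kj; apply/eqP/negPn/negP => mj.
by apply: noj; exists j.
Qed.

(** From [K] on, [F] is nonincreasing and bounded below, so it converges; its consecutive
    differences tend to 0 and dominate [c * e k ^+ 2]. *)
Lemma cvg0_of_decrease {F e : nat -> R} {c b : R} {K : nat} : 0 < c ->
  (forall k, b <= F k) -> (forall k, 0 <= e k) ->
  (forall k, (K <= k)%N -> F k.+1 <= F k - c * e k ^+ 2) ->
  e @ \oo --> (0 : R).
Proof.
move=> c0 bF e0 dec.
pose G k := F (k + K)%N.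
have decG k : G k.+1 <= G k - c * e (k + K)%N ^+ 2 by apply: dec; exact: leq_addl.
have cG : cvgn G.
  apply: nonincreasing_is_cvgn; last by exists b => _ [k _ <-]; exact: bF.
  apply/nonincreasing_seqP => k; apply: (le_trans (decG k)).
  by rewrite lerBlDr lerDl mulr_ge0 ?sqr_ge0// ltW.
have cGS : (G k.+1) @[k --> \oo] --> limn G by rewrite (cvg_shiftS G).
have d0 : (G k - G k.+1) @[k --> \oo] --> (0 : R).
  by rewrite -(subrr (limn G)); exact: cvgB.
rewrite -(cvg_shiftn K).
apply/cvgrPdist_lt => eps eps0.
have ceps0 : 0 < c * eps ^+ 2 by rewrite mulr_gt0 ?exprn_gt0.
have /cvgrPdist_lt/(_ _ ceps0) := d0.
apply: filterS => k; rewrite !sub0r !normrN => /(le_lt_trans (ler_norm _)) dk.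
rewrite /= ger0_norm ?e0// -(@ltr_pXn2r _ 2) ?nnegrE ?e0 ?(ltW eps0)//.
rewrite -(ltr_pM2l c0); apply: le_lt_trans dk; have := decG k; lra.
Qed.

End RealSequences.

Lemma lsc_le_limit {R : realType} {T : topologicalType} {f : T -> \bar R}
    {z : nat -> T} {b : nat -> R} {z0 : T} {b0 : R} :
  lower_semicontinuous f -> z @ \oo --> z0 -> b @ \oo --> b0 ->
  (forall j, f (z j) <= (b j)%:E)%E -> (f z0 <= b0%:E)%E.
Proof.
move=> lscf zz bb fzb; rewrite leNgt; apply/negP => b0f.
have [a [b0a af]] : exists a, b0 < a /\ (a%:E < f z0)%E.
  case fE : (f z0) b0f => [r| |] // b0r.
    by rewrite lte_fin in b0r; exists ((b0 + r) / 2); rewrite lte_fin; split; lra.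
  by exists (b0 + 1); rewrite ltry ltrDl.
have [V nV Va] := lscf _ _ af.
have nz : \forall j \near \oo, V (z j) by exact: zz.
have [j [/Va + bja]] := filter_ex (filterI nz (cvgr_lt _ bb _ b0a)).
by move=> /lt_le_trans/(_ (fzb j)); rewrite lte_fin ltNge ltW.
Qed.

(** [phi j] is an index [k >= j] with [x k] within [1 / (j + 1)] of [x0]; [phi] tends to infinity
    but may fail to be increasing. *)
Lemma cluster_subsequence {R : realType} {V : normedModType R} {x : nat -> V}
    {x0 : V} : cluster (x @ \oo) x0 ->
  exists phi : nat -> nat, phi @ \oo --> \oo /\ x \o phi @ \oo --> x0.
Proof.
move=> clx.
have ex j : exists k, (j <= k)%N /\ ball x0 (j.+1%:R^-1 : R) (x k).
  have tl : (x @ \oo) (x @` [set k | (j <= k)%N]).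
    by exists j => // k /= jk; exists k.
  have j0 : (0 : R) < j.+1%:R^-1 by rewrite invr_gt0.
  have [_ [[k jk <-] xk]] := clx _ _ tl (nbhsx_ballx x0 _ j0).
  by exists k.
have [phi phiP] := choice ex; exists phi; split.
  apply/cvgnyPge => N; near=> j.
  by apply: leq_trans (phiP j).1; near: j; exact: nbhs_infty_ge.
apply/cvgrPdist_lt => e e0; near=> j.
have [_] := phiP j; rewrite -ball_normE/= => /lt_trans; apply.
by near: j; exact: near_infty_natSinv_lt (PosNum e0).
Unshelve. all: by end_near. Qed.

(** * Passage to the limit in the subgradient inclusion *)

Section Stationarity.
Context {R : realType} {n : nat} {g : 'rV[R]_n -> R} {h : 'rV[R]_n -> \bar R}.
Hypotheses (h_proper : eproper h) (h_lsc : lower_semicontinuous h).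

Lemma stationary_of_cvg {x xp eta : nat -> 'rV[R]_n} {x0} :
  continuous (grad g) ->
  x @ \oo --> x0 -> xp @ \oo --> x0 -> eta @ \oo --> (0 : 'rV[R]_n) ->
  (forall k, subdifferential h (xp k) (eta k - grad g (x k))) ->
  stationary g h x0.
Proof.
move=> cg xx0 xpx0 eta0 sub.
exists (- grad g x0); last by rewrite subrr.
move=> y; have [hy|] := ltP (h y) +oo%E; last by rewrite leye_eq => /eqP ->; rewrite leey.
have gx : (grad g (x k)) @[k --> \oo] --> grad g x0 by exact: (continuous_cvg _ (cg x0) xx0).
(* The subgradient inequality at [xp k], solved for [h (xp k)]: a convergent real upper bound to
   which semicontinuity applies. *)
pose b k := fine (h y) - dot (eta k - grad g (x k)) (y - xp k).
have bb : b @ \oo --> fine (h y) - dot (0 - grad g x0) (y - x0).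
  apply: cvgB; first exact: cvg_cst.
  by apply: cvg_dot; [exact: cvgB|apply: cvgB => //; exact: cvg_cst].
have hb k : (h (xp k) <= (b k)%:E)%E.
  have := sub k y; rewrite (eproper_dom_fineK h_proper hy) /b EFinB.
  by rewrite leeBrDr.
have := lsc_le_limit h_lsc xpx0 bb hb.
by rewrite sub0r EFinB -(eproper_dom_fineK h_proper hy) leeBrDr.
Qed.

End Stationarity.

(** * Estimates along a run of the algorithm *)

Section Run.
Context {R : realType} {n : nat} {g : 'rV[R]_n -> R} {h : 'rV[R]_n -> \bar R}
  {L : R} {P : pncg_param R} {x xp eta dt d : nat -> 'rV[R]_n} {mu nu : nat -> R}.
Hypotheses (h_proper : eproper h) (h_lsc : lower_semicontinuous h)
  (h_convex : econvex h) (L0 : 0 < L)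
  (lip : forall u v, l2norm (grad g u - grad g v) <= L * l2norm (u - v))
  (desc : forall u v,
    g v <= g u + dot (grad g u) (v - u) + L / 2 * l2norm (v - u) ^+ 2)
  (run : pncg_run P g h x xp eta dt d mu nu).

Let mu_prev k := if k is k'.+1 then mu k' else mu_init P.

(** By the descent lemma every trial [m <= 1 / L] is accepted, so a rejected [mu k / kappa P]
    exceeds [1 / L]. *)
Lemma run_mu_step k : 0 < mu_prev k ->
  [/\ 0 < mu k, mu k <= mu_prev k,
      g (xp k) <= g (x k) + dot (grad g (x k)) (xp k - x k)
        + (2 * mu k)^-1 * l2norm (xp k - x k) ^+ 2
    & mu k = mu_prev k \/ mu k <= kappa P * mu_prev k /\ kappa P / L <= mu k].
Proof.
move=> prev0.
have [mu0 le_prev acc rej] := largest_geometric prev0 (kappa01 P) (run_mu run k).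
rewrite (run_xp run); split => //.
case: rej => [e|[le_kappa nQ]]; [by left|right; split=> [//|]].
rewrite leNgt; apply/negP => small; apply: nQ.
have /andP[kap0 _] := kappa01 P.
set m := mu k / kappa P; have m0 : 0 < m by rewrite divr_gt0.
apply: (le_trans (desc (x k) _)); rewrite lerD2l ler_wpM2r ?sqr_ge0//.
rewrite invfM mulrC ler_wpM2l ?invr_ge0//.
by rewrite -(invrK L) lef_pV2 ?posrE ?invr_gt0// /m ler_pdivrMr// mulrC ltW.
Qed.

Lemma run_mu_gt0 k : 0 < mu k.
Proof.
by elim: k => [|k IH]; [have [] := @run_mu_step 0 (mu_init_gt0 P)|
  have [] := @run_mu_step k.+1 IH].
Qed.

Lemma run_mu_prev_gt0 k : 0 < mu_prev k.
Proof. by case: k => [|k]; [exact: mu_init_gt0|exact: run_mu_gt0]. Qed.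

Lemma run_mu_le_init k : mu k <= mu_init P.
Proof.
have step i : mu i <= mu_prev i by have [] := run_mu_step i (run_mu_prev_gt0 i).
by elim: k => [|k IH]; [exact: (step 0%N)|exact: le_trans (step k.+1) IH].
Qed.

Lemma run_mu_lower_bound : exists2 c : R, 0 < c & forall k, c <= mu k.
Proof.
have /andP[kap0 _] := kappa01 P.
exists (Num.min (mu_init P) (kappa P / L)).
  by rewrite lt_min mu_init_gt0 divr_gt0.
have step i : Num.min (mu_init P) (kappa P / L) <= mu_prev i ->
    Num.min (mu_init P) (kappa P / L) <= mu i.
  have [_ _ _ [->//|[_ le_mu _]]] := run_mu_step i (run_mu_prev_gt0 i).
  by rewrite ge_min le_mu orbT.
by elim=> [|k IH]; apply: step => //; rewrite ge_min lexx.
Qed.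

Lemma run_mu_eventually_constant :
  exists K, forall k, (K <= k)%N -> mu k.+1 = mu k.
Proof.
have [c c0 cmu] := run_mu_lower_bound.
apply: (eventually_constant (kappa01 P) c0 cmu) => k.
by have [_ _ _ [->|[]]] := run_mu_step k.+1 (run_mu_gt0 k); [left|right].
Qed.

Lemma run_etadt k : dot (eta k) (dt k) = - l2norm (eta k) ^+ 2.
Proof.
case: k => [|k]; first by rewrite (run_dt0 run) dotNr sqr_l2norm.
by have [_ _ ->] := run_dtS run k; exact: cg_direction_descent.
Qed.

(** Puts both branches in the form [s = a d] required by [cg_direction_bound]. In step 4.2 the
    overwritten direction [- eta k] has [a = mu k]. *)
Lemma run_displacement k :
  d k != 0 /\ exists2 a, 0 < a & x k.+1 - x k = a *: d k.
Proof.
have nz v : dot (eta k) v = - l2norm (eta k) ^+ 2 -> v != 0.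
  move=> ev; apply/eqP => v0; move/eqP: ev; rewrite v0 -(scale0r 0) dotZr mul0r.
  by rewrite eq_sym oppr_eq0 expf_eq0/= l2norm_eq0 (negbTE (run_infinite run k)).
have [[t [alpha [[succ _] arm dE ->]]]|[_ dE ->]] := run_update run k.
  rewrite dE; split; first exact/nz/run_etadt.
  exists alpha; last by rewrite addrAC subrr add0r.
  have [t0 _ _ _] := largest_geometric ltr01 (theta01 P) succ.
  by have [] := largest_geometric t0 (tau01 P) arm.
rewrite dE; split; first by rewrite oppr_eq0 (run_infinite run).
exists (mu k); first exact: run_mu_gt0.
by rewrite (run_eta run) opprK scalerA divff ?scale1r// gt_eqF// run_mu_gt0.
Qed.

Lemma run_direction_bound : exists D K, 0 < D /\
  forall k, (K <= k)%N -> l2norm (dt k) <= D * l2norm (eta k).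
Proof.
have [K muK] := run_mu_eventually_constant.
have [c c0 cmu] := run_mu_lower_bound.
have nubar0 := nubar_gt0 P.
have C0 : 0 <= 2 / c + L by rewrite addr_ge0 ?divr_ge0 ?ltW.
(* [2 / c + L] is a Lipschitz constant of the residual map for all [mu >= c]. The shift to [K.+1] is
   due to [dt k.+1], which compares residuals at [k] and [k.+1] taken with the same [mu]. *)
exists (1 + 2 * (2 / c + L) / nubar P), K.+1; split.
  by rewrite ltr_pwDl// divr_ge0 ?mulr_ge0// ltW.
case=> [//|k]; rewrite ltnS => Kk.
have [_ curv ->] := run_dtS run k.
have [dk0 [a a0 sE]] := run_displacement k.
apply: (cg_direction_bound a0 nubar0 C0 dk0 sE curv).
rewrite !(run_eta run) !(run_xp run) muK//.
apply: (le_trans (fb_residual_lipschitz h_proper h_lsc h_convex _ _ (run_mu_gt0 k) (lip _ _))).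
rewrite ler_wpM2r ?l2norm_ge0// lerD2r ler_wpM2l//.
by rewrite lef_pV2 ?posrE ?run_mu_gt0.
Qed.

Lemma run_dom k : (h (x k) < +oo)%E.
Proof.
elim: k => [|k IH].
  have [//|] := ltP (h (x 0%N)) +oo%E; rewrite leye_eq => /eqP hoo.
  by have := run_start run; rewrite /edom/= /composite hoo addey.
have [[t [alpha [[_ _] [[_ arm] _] dE ->]]]|[_ _ ->]] := run_update run k; last first.
  by rewrite (run_xp run); exact/prox_dom/run_mu_gt0.
move: arm; rewrite dE /composite (eproper_dom_fineK h_proper IH) -!EFinD.
have [//|] := ltP (h (x k + alpha *: dt k)) +oo%E; rewrite leye_eq => /eqP ->.
by rewrite addey.
Qed.

Let f k := g (x k) + fine (h (x k)).

(** Either the initial step, larger than [tbar P], is kept, or the step is [tau P] times a rejected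
    one; steps [a] with [L / 2 a D^2 <= T - delta] are never rejected. *)
Let alpha_min (D : R) :=
  Num.min (tbar P) (tau P * (2 * (bigT P - delta P) / (L * D ^+ 2))).

(** The minimum covers the two branches: the Armijo test with [eta . dt = - |eta|^2] and step at
    least [alpha_min D], or a forward-backward step. *)
Lemma run_decrease {D : R} k : 0 < D -> l2norm (dt k) <= D * l2norm (eta k) ->
  f k.+1 <= f k - Num.min (delta P * alpha_min D) (mu k / 2) * l2norm (eta k) ^+ 2.
Proof.
move=> D0 dtD.
have e20 : 0 <= l2norm (eta k) ^+ 2 by rewrite sqr_ge0.
have domS := run_dom k.+1; have dom := run_dom k.
rewrite /f; have [[t [alpha [[succ tb] arm dE xE]]]|[_ dE xE]] := run_update run k; last first.
  have [mu0 _ acc _] := run_mu_step k (run_mu_prev_gt0 k).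
  rewrite xE (run_xp run); rewrite (run_xp run) in acc.
  apply: (le_trans (fb_step_decrease h_proper h_lsc h_convex _ mu0 dom acc)).
  rewrite -(run_xp run) -(run_eta run) lerD2l lerN2 ler_wpM2r//.
  by rewrite ge_min lexx orbT.
have [t0 t1 init _] := largest_geometric ltr01 (theta01 P) succ.
have [a0 a_t armQ rej] := largest_geometric t0 (tau01 P) arm.
have /andP[del0 _] := delta01 P; have /andP[tau0 tau1] := tau01 P.
have amin : alpha_min D <= alpha.
  rewrite /alpha_min ge_min; case: rej => [->|[a_tau nQ]]; first by rewrite ltW.
  apply/orP; right; rewrite leNgt; apply/negP => small; apply: nQ.
  apply: (linesearch_decrease h_proper h_convex (desc _) _ dom init _ (run_etadt k)).
    by rewrite divr_gt0//= ler_pdivrMr// mulrC.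
  set a := alpha / tau P; have aP : 0 < a by rewrite divr_gt0.
  have LD0 : 0 < L * D ^+ 2 by rewrite mulr_gt0 ?exprn_gt0.
  have {}small : a * (L * D ^+ 2) <= 2 * (bigT P - delta P).
    by rewrite -ler_pdivlMr// /a ler_pdivrMr// mulrC ltW.
  have dt2 : l2norm (dt k) ^+ 2 <= D ^+ 2 * l2norm (eta k) ^+ 2.
    rewrite -exprMn ler_pXn2r ?nnegrE ?mulr_ge0 ?l2norm_ge0//; exact: ltW.
  have La0 : 0 <= L / 2 * a by rewrite !mulr_ge0 ?invr_ge0// ltW.
  apply: (le_trans (ler_wpM2l La0 dt2)).
  have := ler_wpM2r e20 small; lra.
move: armQ; rewrite -dE -xE /composite dE run_etadt.
rewrite (eproper_dom_fineK h_proper dom) (eproper_dom_fineK h_proper domS).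
rewrite -!EFinD lee_fin => /le_trans; apply.
rewrite lerD2l mulrN lerN2 ler_wpM2r//.
by rewrite ge_min ler_wpM2l// ltW.
Qed.

Lemma run_eta_cvg0 : (exists m : R, forall u, (m%:E <= composite g h u)%E) ->
  (fun k => l2norm (eta k)) @ \oo --> (0 : R).
Proof.
move=> [m fm].
have [D [K [D0 dtD]]] := run_direction_bound.
have [c c0 cmu] := run_mu_lower_bound.
have /andP[del0 _] := delta01 P; have /andP[tau0 tau1] := tau01 P.
have /andP[tb0 _] := tbar01 P; have Tdel := bigT_gt_delta P.
have amin0 : 0 < alpha_min D.
  by rewrite lt_min tb0/= !(mulr_gt0, invr_gt0, exprn_gt0)// subr_gt0.
(* Replacing [mu k] by its lower bound [c] makes the decrease constant independent of [k]. *)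
apply: (@cvg0_of_decrease _ f _ (Num.min (delta P * alpha_min D) (c / 2)) m K).
- by rewrite lt_min mulr_gt0//= divr_gt0.
- move=> k; have := fm (x k); rewrite /composite.
  by rewrite (eproper_dom_fineK h_proper (run_dom k)) -EFinD lee_fin.
- by move=> k; exact: l2norm_ge0.
move=> k Kk; apply: (le_trans (run_decrease k D0 (dtD k Kk))).
rewrite lerD2l lerN2 ler_wpM2r ?sqr_ge0// le_min !ge_min lexx/=.
by rewrite ler_pM2r ?invr_gt0// cmu orbT.
Qed.

Lemma run_xp_cvg {x0 : 'rV[R]_n} {phi : nat -> nat} :
  (fun k => l2norm (eta k)) @ \oo --> (0 : R) -> phi @ \oo --> \oo ->
  x \o phi @ \oo --> x0 ->
  eta \o phi @ \oo --> (0 : 'rV[R]_n) /\ xp \o phi @ \oo --> x0.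
Proof.
move=> eta0 phioo xx0.
have etaphi : eta \o phi @ \oo --> (0 : 'rV[R]_n).
  apply/cvgr0Pnorm_lt => e e0.
  have /cvgrPdist_lt/(_ _ e0) : l2norm (eta (phi k)) @[k --> \oo] --> (0 : R).
    exact: (cvg_comp _ _ phioo eta0).
  apply: filterS => k; rewrite sub0r normrN => /(le_lt_trans (ler_norm _)).
  by apply: le_lt_trans; exact: mx_norm_le_l2norm.
split => //.
have diff : (xp (phi k) - x (phi k)) @[k --> \oo] --> (0 : 'rV[R]_n).
  apply/cvgr0Pnorm_lt => e e0.
  have M0 := mu_init_gt0 P.
  (* The gap [xp - x] is [- mu eta], and [mu] never exceeds [mu_init P]. *)
  have eM : 0 < e / mu_init P by rewrite divr_gt0.
  have /cvgr0Pnorm_lt/(_ _ eM) := etaphi.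
  apply: filterS => k /=; rewrite ltr_pdivlMr//; apply: le_lt_trans.
  have -> : xp (phi k) - x (phi k) = - (mu (phi k) *: eta (phi k)).
    rewrite (run_eta run) scalerN opprK scalerA divff ?scale1r// gt_eqF//.
    exact: run_mu_gt0.
  rewrite normrN normrZ mulrC ler_wpM2l// ger0_norm ?run_mu_le_init//.
  by rewrite ltW// run_mu_gt0.
have -> : xp \o phi = (fun k => (xp (phi k) - x (phi k)) + x (phi k)).
  by apply/funext => k /=; rewrite subrK.
by rewrite -(add0r x0); exact: cvgD.
Qed.

End Run.

Theorem theorem1 (R : realType) (n : nat)
    (g : 'rV[R]_n -> R) (h : 'rV[R]_n -> \bar R)
    (g_C1 : C1 g)
    (g_lip : exists2 L : R, 0 < L &
      forall u v, l2norm (grad g u - grad g v) <= L * l2norm (u - v))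
    (h_proper : eproper h) (h_lsc : lower_semicontinuous h)
    (h_convex : econvex h)
    (P : pncg_param R)
    (x xp eta dt d : nat -> 'rV[R]_n) (mu nu : nat -> R)
    (run : pncg_run P g h x xp eta dt d mu nu)
    (f_bounded_below : exists m : R, forall u, (m%:E <= composite g h u)%E) :
  ((fun k => l2norm (eta k)) @ \oo --> (0 : R)) /\
  (bounded_fun x ->
     forall xbar, cluster (x @ \oo) xbar -> stationary g h xbar).
Proof.
have [L L0 lip] := g_lip.
have desc := descent_lemma L g_C1.1 lip.
have eta0 := run_eta_cvg0 h_proper h_lsc h_convex L0 lip desc run f_bounded_below.
split => // _ xbar /cluster_subsequence[phi [phioo xphi]].
have [etaphi xpphi] := run_xp_cvg L0 desc run eta0 phioo xphi.
apply: (stationary_of_cvg h_proper h_lsc g_C1.2 xphi xpphi etaphi) => k /=.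
rewrite (run_eta run) (run_xp run); apply: fb_step_subgradient => //.
exact: (run_mu_gt0 L0 desc run).
Qed.
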